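(* Let $m\ge 2$, let $D\subsetneq \mathbb{R}^m$ be an open set, and let $d_D$ be the signed distance function to $\partial D$. Let $p\in\partial D$ and let $U$ be a neighborhood of $p$. If $d_D$ is differentiable at $p$ and at every point of $U\cap D$, then $|\nabla d_D(p)|=1$.
   Context: $|\cdot|$ is the Euclidean norm on $\mathbb{R}^m$. For $D\subsetneq\mathbb{R}^m$ open (with nonempty boundary), set $\delta_D(x):=\min_{y\in\partial D}|x-y|$. The signed distance function $d_D:\mathbb{R}^m\to\mathbb{R}$ is defined by $d_D:=\delta_D$ on $D$ and $d_D:=-\delta_D$ on $\mathbb{R}^m\setminus D$. Differentiability means (total, Fréchet) differentiability of $d_D$ as a function on $\mathbb{R}^m$. *)

(* Defs.v *)
From HB Require Import structures.
From mathcomp Require Import all_boot all_order all_algebra.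
From mathcomp Require Import all_classical all_reals all_analysis.
Set Implicit Arguments.
Unset Strict Implicit.
Unset Printing Implicit Defensive.
Import Order.TTheory GRing.Theory Num.Theory.
Import numFieldNormedType.Exports.

Local Open Scope classical_set_scope.
Local Open Scope ring_scope.

Definition boundary (T : topologicalType) (A : set T) : set T :=
  closure A `\` A°.

(* The library norm `|x| on 'rV[R]_m is the sup norm; it induces the same
   topology and the same notion of differentiability. *)
Definition enorm (R : realType) (m : nat) (x : 'rV[R]_m) : R :=
  Num.sqrt (\sum_(i < m) x 0 i ^+ 2).

Definition bdist (R : realType) (m : nat) (D : set 'rV[R]_m) (x : 'rV[R]_m) : R :=
  inf [set enorm (x - y) | y in boundary D].

Definition sdist (R : realType) (m : nat) (D : set 'rV[R]_m) (x : 'rV[R]_m) : R :=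
  if x \in D then bdist D x else - bdist D x.

Definition gradient (R : realType) (m : nat) (f : 'rV[R]_m -> R) (x : 'rV[R]_m) :
    'rV[R]_m :=
  \row_(i < m) 'D_(delta_mx 0 i) f x.

Lemma boundary_closed (T : topologicalType) (A : set T) : closed (boundary A).
Proof.
rewrite /boundary setDE; apply: closedI; first exact: closed_closure.
by apply: open_closedC; exact: open_interior.
Qed.

Lemma enorm_continuous (R : realType) (m : nat) : continuous (@enorm R m).
Proof.
suff sumc (s : seq 'I_m) :
    continuous (fun x : 'rV[R]_m => \sum_(i <- s) x 0 i ^+ 2 : R).
  move=> x; apply: (continuous_comp (g := Num.sqrt)); first exact: sumc.
  exact: sqrt_continuous.
elim: s => [|i s IHs] x.
  rewrite (_ : (fun _ => _) = cst 0); first exact: cst_continuous.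
  by apply/funext => z; rewrite big_nil.
pose sq (z : 'rV[R]_m) : R := z 0 i * z 0 i.
rewrite (_ : (fun _ => _) = sq \+ (fun z => \sum_(j <- s) z 0 j ^+ 2)).
  apply: continuousD; last exact: IHs.
  by apply: continuousM; exact: coord_continuous.
by apply/funext => z; rewrite big_cons /= expr2.
Qed.

Lemma norm_le_enorm (R : realType) (m : nat) (x : 'rV[R]_m) : `|x| <= enorm x.
Proof.
rewrite [leLHS]/Num.Def.normr /= mx_normrE; apply: bigmax_le.
  exact: sqrtr_ge0.
move=> [i j] _ /=; rewrite ord1 -sqrtr_sqr ler_wsqrtr //.
by rewrite (bigD1 j) //= lerDl sumr_ge0 // => k _; exact: sqr_ge0.
Qed.

(* The infimum in bdist is a minimum as soon as the boundary is nonempty. *)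
Lemma bdist_min (R : realType) (m : nat) (D : set 'rV[R]_m) (x : 'rV[R]_m) :
  boundary D !=set0 ->
  exists2 y, boundary D y &
    bdist D x = enorm (x - y) /\
    forall z, boundary D z -> enorm (x - y) <= enorm (x - z).
Proof.
move=> [y0 By0].
have ec : continuous (fun y : 'rV[R]_m => enorm (x - y)).
  move=> y.
  refine (@continuous_comp _ _ _ (fun z : 'rV[R]_m => x - z) (@enorm R m) y _ _).
    by apply: continuousB; [exact: cst_continuous|move=> ?; exact: cvg_id].
  exact: enorm_continuous.
pose K := boundary D `&` [set y | enorm (x - y) <= enorm (x - y0)].
have K0 : K !=set0 by exists y0; split => //=.
have Kc : compact K.
  apply: bounded_closed_compact.
    exists (`|x| + enorm (x - y0)); split; first exact: num_real.
    move=> M HM y [_ /= yle]; apply/ltW/(le_lt_trans _ HM).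
    have -> : y = x - (x - y) by rewrite subKr.
    rewrite (le_trans (ler_normB _ _)) // lerD2l.
    exact: le_trans (norm_le_enorm _) yle.
  apply: closedI; first exact: boundary_closed.
  exact: (preimage_closed (fun y _ => ec y) (@closed_le _ (enorm (x - y0)))).
have [|y /set_mem[By yle] ymin] :=
    compact_EVT_min K0 Kc (f := fun y : 'rV[R]_m => enorm (x - y)).
  exact: continuous_subspaceT.
have ymin' z : boundary D z -> enorm (x - y) <= enorm (x - z).
  move=> Bz; have [zle|/ltW zge] := leP (enorm (x - z)) (enorm (x - y0)).
    by apply: ymin; rewrite inE.
  exact: le_trans yle zge.
exists y => //; split => //; apply/eqP; rewrite eq_le; apply/andP; split.
  apply: ge_inf; last by exists y.
  by exists (enorm (x - y)) => _ [z Bz <-]; exact: ymin'.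
apply: lb_le_inf; first by exists (enorm (x - y0)); exists y0.
by move=> _ [z Bz <-]; exact: ymin'.
Qed.

(* Main.v *)
Require Import Defs.
From HB Require Import structures.
From mathcomp Require Import all_boot all_order all_algebra.
From mathcomp Require Import all_classical all_reals all_analysis.
From mathcomp Require Import ring lra.
Set Implicit Arguments.
Unset Strict Implicit.
Unset Printing Implicit Defensive.
Import Order.TTheory GRing.Theory Num.Theory.
Import numFieldNormedType.Exports.

Local Open Scope classical_set_scope.
Local Open Scope ring_scope.

(** Write [d] for the signed distance, [g] for its gradient at [p] and |.| for
the Euclidean norm.

The bound |g| <= 1 holds because [|d w| <= |w - p|] for every [w]
([sdist_le]): moving from [p] along [g] by a small step [t], the function [d]
changes by about [t * |g|^2], while the length of the move is [t * |g|].

For |g| >= 1 it is enough to find, in arbitrarily small balls of radius [s]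
around [p], points at which [d] is almost [s]: the first order expansion of
[d] at [p], where [d p = 0], bounds [d] by [|g| * s + o(s)] on such a ball.
These points come from the following two facts.

- At a point [x] of [D] where [d] is differentiable, [d] increases with slope
  at least 1 in the direction away from a nearest boundary point [y].
  Moving from [x] straight towards [y] decreases the distance at speed at
  least 1, and a two-sided derivative turns this into information about the
  opposite direction ([sdist_derive_away]).

- Fix [c < 1] and [x] in [D], and maximise [d w - c * |w - x|] over a closed
  ball around [x]. The maximiser cannot be interior, as the slope there
  exceeds [c]; so it lies on the sphere, where [d] is at least [c] times the
  radius ([bdist_ascent]). This replaces the integration of the gradient flow
  of the distance by a compactness argument.

Taking [x] in [D] close to [p], with [c] close to 1, gives the required
points. *)

(** * The Euclidean norm on row vectors *)

Definition dotv (R : realType) (m : nat) (x y : 'rV[R]_m) : R :=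
  \sum_(i < m) x 0 i * y 0 i.

Lemma enorm_ge0 (R : realType) (m : nat) (x : 'rV[R]_m) : 0 <= enorm x.
Proof. exact: sqrtr_ge0. Qed.

Lemma enorm_sqr (R : realType) (m : nat) (x : 'rV[R]_m) :
  enorm x ^+ 2 = dotv x x.
Proof.
rewrite sqr_sqrtr; last by apply: sumr_ge0 => i _; exact: sqr_ge0.
by apply: eq_bigr => i _; rewrite expr2.
Qed.

Lemma enorm0 (R : realType) (m : nat) : enorm (0 : 'rV[R]_m) = 0.
Proof.
by rewrite /enorm big1 ?sqrtr0 // => i _; rewrite mxE expr0n.
Qed.

Lemma enormZ (R : realType) (m : nat) (a : R) (x : 'rV[R]_m) :
  enorm (a *: x) = `|a| * enorm x.
Proof.
rewrite /enorm -sqrtr_sqr -sqrtrM ?sqr_ge0 // mulr_sumr; congr Num.sqrt.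
by apply: eq_bigr => i _; rewrite mxE exprMn.
Qed.

Lemma enormN (R : realType) (m : nat) (x : 'rV[R]_m) : enorm (- x) = enorm x.
Proof. by rewrite -scaleN1r enormZ normrN1 mul1r. Qed.

Lemma enorm_distC (R : realType) (m : nat) (x y : 'rV[R]_m) :
  enorm (x - y) = enorm (y - x).
Proof. by rewrite -enormN opprB. Qed.

Lemma enorm_eq0 (R : realType) (m : nat) (x : 'rV[R]_m) :
  enorm x = 0 -> x = 0.
Proof.
move=> x0; apply/eqP; rewrite -normr_eq0 eq_le normr_ge0 andbT.
by rewrite -x0 norm_le_enorm.
Qed.

Lemma dotv_le_enorm (R : realType) (m : nat) (x y : 'rV[R]_m) :
  dotv x y <= enorm x * enorm y.
Proof.
have [/eqP|x0] := eqVneq (enorm x * enorm y) 0.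
  rewrite mulf_eq0 => xy0.
  suff -> : dotv x y = 0 by rewrite mulr_ge0 ?enorm_ge0.
  by case/orP: xy0 => /eqP/enorm_eq0 ->; apply: big1 => i _;
    rewrite mxE ?mul0r ?mulr0.
(* Cauchy-Schwarz is the nonnegativity of | |y| x - |x| y |^2. *)
have : 0 <= dotv (enorm y *: x - enorm x *: y) (enorm y *: x - enorm x *: y).
  by rewrite -enorm_sqr sqr_ge0.
have -> : dotv (enorm y *: x - enorm x *: y) (enorm y *: x - enorm x *: y) =
    2 * (enorm x * enorm y) * (enorm x * enorm y - dotv x y).
  set a := enorm x; set b := enorm y.
  transitivity (b ^+ 2 * dotv x x + a ^+ 2 * dotv y y - 2 * a * b * dotv x y).
    rewrite /dotv !mulr_sumr -big_split /= -sumrB.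
    by apply: eq_bigr => i _; rewrite !mxE; ring.
  by rewrite -!enorm_sqr -/a -/b; ring.
rewrite pmulr_rge0 ?subr_ge0 // mulr_gt0 // lt_neqAle eq_sym x0 /=.
by rewrite mulr_ge0 ?enorm_ge0.
Qed.

Lemma enormD (R : realType) (m : nat) (x y : 'rV[R]_m) :
  enorm (x + y) <= enorm x + enorm y.
Proof.
rewrite -(@ler_pXn2r _ 2%N) ?nnegrE ?addr_ge0 ?enorm_ge0 //.
have -> : enorm (x + y) ^+ 2 = dotv x x + dotv y y + 2 * dotv x y.
  rewrite enorm_sqr /dotv mulr_sumr -!big_split /=.
  by apply: eq_bigr => i _; rewrite !mxE; ring.
rewrite -!enorm_sqr; have := dotv_le_enorm x y; lra.
Qed.

(** * The distance to the boundary *)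

Lemma bdist_le (R : realType) (m : nat) (D : set 'rV[R]_m) (x y : 'rV[R]_m) :
  boundary D y -> bdist D x <= enorm (x - y).
Proof.
move=> By; have [|z Bz [-> zmin]] := @bdist_min _ _ D x; first by exists y.
exact: zmin.
Qed.

Lemma bdist_lipschitz (R : realType) (m : nat) (D : set 'rV[R]_m)
    (x y : 'rV[R]_m) :
  boundary D !=set0 -> bdist D x <= bdist D y + enorm (x - y).
Proof.
move=> B0; have [z Bz [-> _]] := bdist_min y B0.
apply: le_trans (bdist_le x Bz) _.
have -> : x - z = (x - y) + (y - z) by rewrite addrA subrK.
by rewrite [leRHS]addrC enormD.
Qed.

Lemma bdist_ge0 (R : realType) (m : nat) (D : set 'rV[R]_m) (x : 'rV[R]_m) :
  boundary D !=set0 -> 0 <= bdist D x.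
Proof. by move=> B0; have [z _ [-> _]] := bdist_min x B0; exact: enorm_ge0. Qed.

Lemma bdist_eq0 (R : realType) (m : nat) (D : set 'rV[R]_m) (x : 'rV[R]_m) :
  boundary D !=set0 -> bdist D x = 0 <-> boundary D x.
Proof.
move=> B0; split=> [x0|Bx].
  have [z Bz [zE _]] := bdist_min x B0.
  have /enorm_eq0/eqP : enorm (x - z) = 0 by rewrite -zE.
  by rewrite subr_eq0 => /eqP ->.
apply/eqP; rewrite eq_le bdist_ge0 // andbT.
by have := bdist_le x Bx; rewrite subrr enorm0.
Qed.

Lemma enormB_continuous (R : realType) (m : nat) (x : 'rV[R]_m) :
  continuous (fun w : 'rV[R]_m => enorm (w - x)).
Proof.
move=> w.
apply: (@continuous_comp _ _ _ (fun z : 'rV[R]_m => z - x) (@enorm R m)).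
  by apply: continuousB; [move=> ?; exact: cvg_id|exact: cst_continuous].
exact: enorm_continuous.
Qed.

(** Euclidean balls are neighbourhoods for the topology of the sup norm. *)
Lemma enormB_lt (R : realType) (m : nat) (x : 'rV[R]_m) (e : R) :
  0 < e -> \forall w \near x, enorm (w - x) < e.
Proof.
move=> e0; have := @enormB_continuous R m x x.
by move=> /cvgr_lt; apply; rewrite subrr enorm0.
Qed.

Lemma bdist_continuous (R : realType) (m : nat) (D : set 'rV[R]_m) :
  boundary D !=set0 -> continuous (bdist D).
Proof.
move=> B0 x.
apply/(@cvgrPdist_lt _ _ _ (nbhs x)) => e egt0.
apply: filterS (enormB_lt x egt0) => w we.
rewrite ltr_norml; have := bdist_lipschitz x w B0.
have := bdist_lipschitz w x B0; rewrite [enorm (x - w)]enorm_distC.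
by move=> *; apply/andP; split; lra.
Qed.

(** * The signed distance and its slope inside the domain *)

Lemma boundary_open (T : topologicalType) (D : set T) :
  open D -> boundary D = closure D `\` D.
Proof. by move=> /interior_id Do; rewrite /boundary Do. Qed.

Lemma sdist_in (R : realType) (m : nat) (D : set 'rV[R]_m) (x : 'rV[R]_m) :
  D x -> sdist D x = bdist D x.
Proof. by move=> Dx; rewrite /sdist mem_set. Qed.

Lemma sdist_le (R : realType) (m : nat) (D : set 'rV[R]_m) (x y : 'rV[R]_m) :
  boundary D y -> `|sdist D x| <= enorm (x - y).
Proof.
move=> By; have B0 : boundary D !=set0 by exists y.
have -> : `|sdist D x| = `|bdist D x|.
  by rewrite /sdist; case: ifP => _ //; rewrite [LHS]normrN.
by rewrite ger0_norm; [exact: bdist_le|exact: bdist_ge0].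
Qed.

Lemma sdist_boundary (R : realType) (m : nat) (D : set 'rV[R]_m)
    (x : 'rV[R]_m) : boundary D x -> sdist D x = 0.
Proof.
move=> Bx; apply/eqP; rewrite -normr_eq0 eq_le normr_ge0 andbT.
by have := sdist_le x Bx; rewrite subrr enorm0.
Qed.

(** The point [x + h (x - y)], for [-1 < h < 0], is on the segment from [x] to
[y], hence at distance at most [(1 + h) |x - y|] from the boundary. So the
difference quotients from the left are at least [|x - y|], and they have the
same limit as those from the right, about which the choice of [y] says nothing
directly. *)
Lemma sdist_derive_away (R : realType) (m : nat) (D : set 'rV[R]_m)
    (x y : 'rV[R]_m) :
  open D -> D x -> derivable (sdist D) x (x - y) ->
  boundary D y -> bdist D x = enorm (x - y) ->
  bdist D x <= 'D_(x - y) (sdist D) x.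
Proof.
move=> Do Dx dD By xy.
have -> : 'D_(x - y) (sdist D) x =
    lim ((h^-1 *: ((sdist D \o shift x) (h *: (x - y)) - sdist D x))
      @[h --> 0^'-]).
  by rewrite /derive; apply: cvg_at_leftE.
apply: limr_ge.
  by apply/cvg_ex; exists ('D_(x - y) (sdist D) x); apply: cvg_dnbhs_at_left.
near=> h.
have h0 : h < 0 by near: h; exact: nbhs_left_lt.
have h1 : -1 < h by near: h; apply: nbhs_left_gt; rewrite ltrN10.
rewrite /= [sdist D x]sdist_in //.
have : sdist D (h *: (x - y) + x) <= (1 + h) * enorm (x - y).
  apply: le_trans (ler_norm _) _; apply: le_trans (sdist_le _ By) _.
  rewrite -addrA -[X in _ + X]scale1r -scalerDl enormZ addrC ger0_norm //; lra.
rewrite -xy => le1.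
have -> : h^-1 *: (sdist D (h *: (x - y) + x) - bdist D x) =
    h^-1 * (sdist D (h *: (x - y) + x) - bdist D x) by [].
by rewrite ler_ndivlMl //; lra.
Unshelve. all: by end_near. Qed.

(** * Climbing away from the boundary *)

Lemma compact_closedI_eball (R : realType) (m : nat) (A : set 'rV[R]_m)
    (x : 'rV[R]_m) (r : R) :
  closed A -> compact (A `&` [set w | enorm (w - x) <= r]).
Proof.
move=> Ac; apply: bounded_closed_compact.
  exists (r + `|x|); split; first exact: num_real.
  move=> M HM y [_ /= yr]; apply/ltW/(le_lt_trans _ HM).
  rewrite -[y](subrK x) (le_trans (ler_normD _ _)) // lerD2r.
  exact: le_trans (norm_le_enorm _) yr.
apply: closedI => //.
exact: (preimage_closed (fun y _ => @enormB_continuous R m x y)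
  (@closed_le _ r)).
Qed.

(** By [sdist_derive_away] the slope exceeds [c] at every point of [D] in the
ball, so a maximiser of the distance penalised by [c] times the length of the
move is on the sphere of radius [r]. The maximum of
[g w = bdist D w - c * |w - x|] is taken over the intersection
of the ball with the closure of [D], to have compactness; the maximiser is
still in [D], because its distance to the boundary is at least that of [x]. *)
Lemma bdist_ascent (R : realType) (m : nat) (D : set 'rV[R]_m)
    (x : 'rV[R]_m) (r c : R) :
  open D -> boundary D !=set0 -> D x -> 0 <= r -> 0 <= c < 1 ->
  (forall w, enorm (w - x) <= r -> D w -> differentiable (sdist D) w) ->
  exists z, [/\ D z, enorm (z - x) <= r & c * r <= bdist D z].
Proof.
move=> Do B0 Dx r0 /andP[c0 c1] dD.
have nB w : D w -> ~ boundary D w by rewrite boundary_open // => Dw [].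
pose g w := bdist D w - c * enorm (w - x).
have gc : continuous g.
  move=> w; apply: (@continuousB _ _ _ (bdist D) (fun w => c * enorm (w - x))).
    exact: bdist_continuous.
  apply: (@cvgM _ _ (nbhs w) _ (cst c)); first exact: cvg_cst.
  exact: enormB_continuous.
pose K := closure D `&` [set w | enorm (w - x) <= r].
have Kx : K x by split; [exact: subset_closure|rewrite /= subrr enorm0].
have [|z /set_mem[cDz /= zr] zmax] := compact_EVT_max (ex_intro _ x Kx)
    (compact_closedI_eball (x := x) (r := r) (@closed_closure _ D)) (f := g).
  exact: continuous_subspaceT.
have gxz : bdist D x + c * enorm (z - x) <= bdist D z.
  by have := zmax x (mem_set Kx); rewrite /g subrr enorm0; lra.
have x0 : 0 < bdist D x.
  rewrite lt_neqAle eq_sym bdist_ge0 // andbT; apply/eqP.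
  by move/(bdist_eq0 x B0); exact: nB.
have cz0 : 0 <= c * enorm (z - x) by rewrite mulr_ge0 ?enorm_ge0.
have z0 : 0 < bdist D z by lra.
have Dz : D z.
  apply: contrapT => nDz.
  suff zE : bdist D z = 0 by move: z0; rewrite zE ltxx.
  by apply/(bdist_eq0 z B0); rewrite boundary_open.
exists z; split=> //.
have [rz|zltr] := leP r (enorm (z - x)).
  by have := ler_wpM2l c0 rz; lra.
(* A maximiser [z] in the open ball is impossible: [g] takes a larger value at
   [z + h (z - y)] for small positive [h], [y] being nearest to [z]. *)
exfalso.
have [y By [zy _]] := bdist_min z B0.
have dz := dD z zr Dz.
have drv : derivable (sdist D) z (z - y) by exact: diff_derivable.
have slope : c * bdist D z < 'D_(z - y) (sdist D) z.
  apply: lt_le_trans (sdist_derive_away Do Dz drv By zy).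
  by rewrite gtr_pMl.
have line : h *: (z - y) + z @[h --> 0^'+] --> z.
  suff : h *: (z - y) + z @[h --> 0^'+] --> 0 *: (z - y) + z.
    by rewrite scale0r add0r.
  apply: cvgD; last exact: cvg_cst.
  by apply: cvgZr_tmp; exact: cvg_at_right_filter.
have D_near : \forall h \near 0^'+, D (h *: (z - y) + z).
  by apply: line; exact: open_nbhs_nbhs.
have ball_near : \forall h \near 0^'+, enorm (h *: (z - y) + z - x) < r.
  apply: (cvgr_lt (enorm (z - x))) => //.
  exact: (@cvg_comp _ _ _ (fun h => h *: (z - y) + z)
    (fun w => enorm (w - x)) _ _ _ line (@enormB_continuous R m x z)).
have quot_near : \forall h \near 0^'+, c * bdist D z <
    h^-1 *: ((sdist D \o shift z) (h *: (z - y)) - sdist D z).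
  by apply: (cvgr_gt ('D_(z - y) (sdist D) z)) => //; exact: cvg_dnbhs_at_right.
near ((0 : R)^'+) => h.
have h0 : 0 < h by near: h; exact: nbhs_right_gt.
have Dh : D (h *: (z - y) + z) by near: h.
have hr : enorm (h *: (z - y) + z - x) < r by near: h.
have : c * bdist D z <
    h^-1 * (sdist D (h *: (z - y) + z) - sdist D z) by near: h.
rewrite ltr_pdivlMl // !sdist_in // => hq.
have := zmax (h *: (z - y) + z) (mem_set (conj (subset_closure Dh) (ltW hr))).
have : enorm (h *: (z - y) + z - x) <= h * bdist D z + enorm (z - x).
  by rewrite -addrA (le_trans (enormD _ _)) // enormZ gtr0_norm // -zy.
move=> /(ler_wpM2l c0); rewrite /g; lra.
Unshelve. all: by end_near.
Qed.

(** * The gradient at a boundary point *)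

Lemma diff_dotv_gradient (R : realType) (m : nat) (f : 'rV[R]_m -> R)
    (p v : 'rV[R]_m) :
  differentiable f p -> 'd f p v = dotv (gradient f p) v.
Proof.
move=> df; rewrite {1}[v]row_sum_delta linear_sum; apply: eq_bigr => i _.
by rewrite linearZ /= mxE deriveE // mulrC.
Qed.

Theorem proposition2 (R : realType) (m : nat) (hm : (2 <= m)%N)
    (D : set 'rV[R]_m) (hDopen : open D) (hDproper : D `<` [set: 'rV[R]_m])
    (p : 'rV[R]_m) (hp : boundary D p)
    (U : set 'rV[R]_m) (hU : nbhs p U)
    (hdiffp : differentiable (sdist D) p)
    (hdiffU : forall x, U x -> D x -> differentiable (sdist D) x) :
  enorm (gradient (sdist D) p) = 1.
Proof.
have B0 : boundary D !=set0 by exists p.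
set g := gradient (sdist D) p.
have [r0 r0gt0 small] : exists2 r : R, 0 < r & forall w : 'rV[R]_m,
   enorm (w - p) < r -> U w.
  case/nbhs_ballP : hU => r r0 rU; exists r => // w wr; apply: rU.
  rewrite -ball_normE /= distrC; exact: le_lt_trans (norm_le_enorm _) wr.
have expand (e : R) : 0 < e -> exists2 r : R, 0 < r & forall h : 'rV[R]_m,
    enorm h < r -> `|sdist D (p + h) - dotv g h| <= e * enorm h.
  move=> e0; have /eqaddoP/(_ e e0) := diff_locally hdiffp.
  case/nbhs_ballP => r rgt0 rE; exists r => // h hr.
  have : ball 0 r h.
    rewrite -ball_normE /= sub0r normrN.
    exact: le_lt_trans (norm_le_enorm _) hr.
  move/rE => /=; rewrite !fctE /= (sdist_boundary hp) add0r.
  rewrite diff_dotv_gradient //.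
  rewrite [h + p]addrC => /le_trans; apply.
  by rewrite ler_pM2l // norm_le_enorm.
apply/eqP; rewrite eq_le; apply/andP; split.
  apply/ler_addgt0Pr => e e0.
  have [r rgt0 rE] := expand e e0.
  have [->|g0] := eqVneq (enorm g) 0; first lra.
  have gp : 0 < enorm g by rewrite lt_neqAle eq_sym g0 enorm_ge0.
  (* The step for which [t *: g] has length [r / 2], inside the ball of validity
     of the expansion. *)
  pose t := r / (2 * enorm g).
  have t0 : 0 < t by rewrite divr_gt0 // mulr_gt0.
  have tg : enorm (t *: g) = t * enorm g by rewrite enormZ gtr0_norm.
  have tr : t * enorm g = r / 2 by rewrite /t invfM mulrA divfK.
  have /rE : enorm (t *: g) < r by rewrite tg tr; lra.
  have := sdist_le (p + t *: g) hp; rewrite [p + _ - _]addrC addKr tg.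
  have -> : dotv g (t *: g) = (t * enorm g) * enorm g.
    rewrite -mulrA -expr2 enorm_sqr /dotv mulr_sumr.
    by apply: eq_bigr => i _; rewrite [(t *: g) 0 i]mxE; ring.
  rewrite !ler_norml => /andP[_ le1] /andP[le2 _].
  have : (t * enorm g) * enorm g <= (t * enorm g) * (1 + e) by lra.
  by rewrite ler_pM2l // mulr_gt0.
apply/ler_addgt0Pr => e e0.
have [r1 r10 rE] := expand (e / 4) (divr_gt0 e0 (ltr0n _ 4)).
(* Losses in units of the radius [s], to be kept below [e] in total: at most
   [2 * k <= e / 4], since both the slope and the radius of the ball around [x]
   are shrunk by [1 - k], and [e / 4] for the remainder of the expansion. *)
pose k := Num.min (e / 8) (1 / 2).
have [k0 ke k2] : [/\ 0 < k, k <= e / 8 & k <= 1 / 2].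
  by split; rewrite /k ?ge_min ?lexx ?orbT // lt_min; apply/andP; split; lra.
pose s := Num.min r0 r1 / 2.
have [s0 sr0 sr1] : [/\ 0 < s, s < r0 & s < r1].
  have m0 : 0 < Num.min r0 r1 by rewrite lt_min r0gt0.
  have ms : s < Num.min r0 r1 by rewrite /s; lra.
  by split; [rewrite /s; lra|apply: lt_le_trans ms _..];
    rewrite ge_min lexx ?orbT.
have [x [Dx xp]] : D `&` [set w | enorm (w - p) < k * s] !=set0.
  by case: hp => cDp _; apply: cDp; apply: enormB_lt; exact: mulr_gt0.
have inball z : enorm (z - x) <= (1 - k) * s -> enorm (z - p) < s.
  move=> zx; have -> : z - p = (z - x) + (x - p) by rewrite addrA subrK.
  have xps : enorm (x - p) < k * s := xp.
  apply: le_lt_trans (enormD _ _) _; lra.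
have [|||z [Dz zx zd]] :=
    @bdist_ascent R m D x ((1 - k) * s) (1 - k) hDopen B0 Dx.
- by apply: mulr_ge0; lra.
- by apply/andP; split; lra.
- move=> w wx; apply: hdiffU; apply: small.
  exact: lt_trans (inball w wx) sr0.
have zs := inball z zx.
have := rE (z - p) (lt_trans zs sr1).
rewrite [p + _]addrC subrK sdist_in // ler_norml => /andP[_ up].
have := dotv_le_enorm g (z - p).
have : enorm g * enorm (z - p) <= enorm g * s.
  by rewrite ler_wpM2l ?enorm_ge0 // ltW.
have : e / 4 * enorm (z - p) <= e / 4 * s by rewrite ler_wpM2l ?ltW //; lra.
have : (1 - e / 4) * s <= (1 - k) * ((1 - k) * s).
  by rewrite mulrA ler_wpM2r ?ltW //; nra.
move=> *; have : s * 1 <= s * (enorm g + e) by nra.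
by rewrite ler_pM2l.
Qed.
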